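(* Let $\mathcal{C}\subset\mathbb{R}^d$ be closed and nonempty, and let $\|\cdot\|$ be any norm on $\mathbb{R}^d$ with dual norm $\|\cdot\|^*$. For $\gamma\in[0,\infty]$ consider the following four properties of a pair $x,y\in\mathcal{C}$: (Curvature) $\displaystyle \limsup_{t\searrow 0}\frac{\min_{z\in\mathcal{C}}\|z-((1-t)x+ty)\|}{t}\le \gamma\|x-y\|_2^2$. (One-sided contraction) For any $z\in\mathbb{R}^d$ with $P_{\mathcal{C}}(z)=x$, $\ (1-\gamma\|z-x\|^* )\cdot\|x-y\|_2\le\|z-y\|_2$. (First-order optimality) For any differentiable $f:\mathbb{R}^d\to\mathbb{R}$ such that $x$ is a local minimizer of $f$ over $\mathcal{C}$, $\ \langle y-x,\nabla f(x)\rangle\ge-\gamma\|\nabla f(x)\|^*\|y-x\|_2^2$. (Inner products) For any $z\in\mathbb{R}^d$ with $P_{\mathcal{C}}(z)=x$, $\ \langle y-x,z-x\rangle\le\gamma\|z-x\|^*\|y-x\|_2^2$. For each choice of property $( * )$ among these four, define for $x\in\mathcal{C}$ $$\gamma_x^{( * )}(\mathcal{C})=\begin{cases}\infty,& x\in\mathcal{C}_{\mathrm{dgn}},\\ \min\{\gamma\in[0,\infty]:\text{property }( * )\text{ holds for this point }x\text{ and any }y\in\mathcal{C}\},& x\in\mathcal{C}\setminus\mathcal{C}_{\mathrm{dgn}}.\end{cases}$$ Then for all $x\in\mathcal{C}$, the value $\gamma_x^{( * )}(\mathcal{C})$ is the same for all four choices of the property $( * )$.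
   Context: $\|\cdot\|_2$ is the Euclidean norm and $\langle\cdot,\cdot\rangle$ the standard inner product. $P_{\mathcal{C}}$ denotes projection in the $\ell_2$ norm: $P_{\mathcal{C}}(z)\in\arg\min_{x\in\mathcal{C}}\|x-z\|_2$; if the minimizer is non-unique, $P_{\mathcal{C}}(z)$ denotes any minimizer, any claim or assumption involving $P_{\mathcal{C}}(z)$ is to hold for every choice, and ''$P_{\mathcal{C}}(z)=x$'' means that $x$ is a minimizer. The set of degenerate points is $\mathcal{C}_{\mathrm{dgn}}=\{x\in\mathcal{C}:P_{\mathcal{C}}\text{ is not continuous over any neighborhood of }x\}$ (neighborhoods in $\mathbb{R}^d$). The convention $0\cdot\infty=0$ is used, so that all properties hold trivially for $\gamma=\infty$. *)

(* Defs.v *)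
From HB Require Import structures.
From mathcomp Require Import all_boot all_order all_algebra.
From mathcomp Require Import all_classical all_reals all_analysis.
Set Implicit Arguments.
Unset Strict Implicit.
Unset Printing Implicit Defensive.
Import Order.TTheory GRing.Theory Num.Theory.
Import numFieldNormedType.Exports.
Local Open Scope classical_set_scope.
Local Open Scope ring_scope.

Section LocalConcavity.
Context {R : realType} {d : nat}.
Implicit Types (C U : set 'rV[R]_d) (N : 'rV[R]_d -> R) (x y z u v : 'rV[R]_d).
Implicit Types (g : \bar R).

Definition dotp u v : R := \sum_(i < d) u 0 i * v 0 i.

(* The library norm `|u| on 'rV[R]_d is the sup norm; it is only used here
   through the topology and differentiability, which do not depend on the
   choice of norm. *)
Definition enorm u : R := Num.sqrt (dotp u u).

Definition is_norm N : Prop :=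
  [/\ forall u v, N (u + v) <= N u + N v,
      forall (a : R) u, N (a *: u) = `|a| * N u
    & forall u, N u = 0 -> u = 0].

Definition dual_norm N v : R := sup [set dotp v u | u in [set u | N u <= 1]].

Definition grad (f : 'rV[R]_d -> R) x : 'rV[R]_d :=
  \row_(i < d) 'D_(delta_mx 0 i) f x.

(* "P_C(z) = x": x is one of the possibly many nearest points of C to z. *)
Definition is_proj C z x : Prop :=
  C x /\ forall y, C y -> enorm (x - z) <= enorm (y - z).

(* Claims about P_C have to hold for every choice of nearest points. *)
Definition proj_continuous_over C U : Prop :=
  forall p : 'rV[R]_d -> 'rV[R]_d,
    (forall z, is_proj C z (p z)) -> {within U, continuous p}.

Definition degenerate C : set 'rV[R]_d :=
  [set x | C x /\ forall U, nbhs x U -> ~ proj_continuous_over C U].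

(* For closed nonempty C this infimum is attained. *)
Definition ndist N C u : R := inf [set N (z - u) | z in C].

(* In \bar R, 0 * +oo = 0, and 1 - +oo = -oo. *)
Definition curvature N C g x y : Prop :=
  (limf_esup (fun t : R => (ndist N C ((1 - t) *: x + t *: y) / t)%:E) 0^'+
     <= g * (enorm (x - y) ^+ 2)%:E)%E.

Definition contraction N C g x y : Prop :=
  forall z, is_proj C z x ->
  ((1 - g * (dual_norm N (z - x))%:E) * (enorm (x - y))%:E
     <= (enorm (z - y))%:E)%E.

Definition first_order N C g x y : Prop :=
  forall f : 'rV[R]_d -> R,
    (forall u, differentiable f u) ->
    (\forall u \near x, C u -> f x <= f u) ->
  (- (g * (dual_norm N (grad f x))%:E * (enorm (y - x) ^+ 2)%:E)
     <= (dotp (y - x) (grad f x))%:E)%E.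

Definition inner_products N C g x y : Prop :=
  forall z, is_proj C z x ->
  ((dotp (y - x) (z - x))%:E
     <= g * (dual_norm N (z - x))%:E * (enorm (y - x) ^+ 2)%:E)%E.

Inductive property := Curvature | Contraction | FirstOrder | InnerProducts.

Definition holds (P : property) N C g x y : Prop :=
  match P with
  | Curvature => curvature N C g x y
  | Contraction => contraction N C g x y
  | FirstOrder => first_order N C g x y
  | InnerProducts => inner_products N C g x y
  end.

Definition admissible (P : property) N C x : set (\bar R) :=
  [set g | (0 <= g)%E /\ forall y, C y -> holds P N C g x y].

(* A minimum over [admissible P N C x] as soon as it belongs to that set. *)
Definition local_concavity (P : property) N C x : \bar R :=
  if `[< degenerate C x >] then +oo%E else ereal_inf (admissible P N C x).

End LocalConcavity.

(* Main.v *)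
Require Import Defs.
From HB Require Import structures.
From mathcomp Require Import all_boot all_order all_algebra.
From mathcomp Require Import all_classical all_reals all_analysis.
From mathcomp Require Import ring lra.
Set Implicit Arguments.
Unset Strict Implicit.
Unset Printing Implicit Defensive.
Import Order.TTheory GRing.Theory Num.Theory.
Import numFieldNormedType.Exports.
Local Open Scope classical_set_scope.
Local Open Scope ring_scope.

(* Curvature implies first-order optimality by testing a local minimiser against
   points of C close to (1 - t) x + t y; first-order optimality for
   f(u) = |u - z|^2 is the inner product condition; expanding squares, and
   moving z towards x, shows that the latter is equivalent to one-sided
   contraction. Nondegeneracy is needed only to return from inner products to
   curvature. Continuity of the projection near x implies that normals to C near
   x are proximal with a uniform constant rho:
     rho <v, u - q> <= |v| |u - q|^2   for q in C near x, v = z - q, P_C(z) = q, u in C.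
   With w = y - x and r = gamma |w|^2, let b_t minimise the distance from
   x + t b to C over the ball N(b - w) <= r, and let t v_t be the residual. The
   inequality above passes to the limit q -> x, so each cluster point of v_t is a
   proximal normal at x; optimality of b_t and the inner product condition
   together force it to vanish. Hence the N-distance from x + t w to C is at most
   r t + o(t). *)

(** * Euclidean inner product and norm *)

Section Euclidean.
Context {R : realType} {d : nat}.
Implicit Types (u v w : 'rV[R]_d) (a : R).

Lemma dotpC u v : dotp u v = dotp v u.
Proof. by apply: eq_bigr => i _; rewrite mulrC. Qed.

Lemma dotpDl u v w : dotp (u + v) w = dotp u w + dotp v w.
Proof. by rewrite -big_split; apply: eq_bigr => i _; rewrite mxE mulrDl. Qed.

Lemma dotpZl a u v : dotp (a *: u) v = a * dotp u v.
Proof. by rewrite mulr_sumr; apply: eq_bigr => i _; rewrite mxE mulrA. Qed.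

Lemma dotpNl u v : dotp (- u) v = - dotp u v.
Proof. by rewrite -scaleN1r dotpZl mulN1r. Qed.

Lemma dotpDr u v w : dotp w (u + v) = dotp w u + dotp w v.
Proof. by rewrite !(dotpC w) dotpDl. Qed.

Lemma dotpZr a u v : dotp v (a *: u) = a * dotp v u.
Proof. by rewrite !(dotpC v) dotpZl. Qed.

Lemma dotpNr u v : dotp v (- u) = - dotp v u.
Proof. by rewrite !(dotpC v) dotpNl. Qed.

Definition dotpE := (dotpDl, dotpDr, dotpNl, dotpNr, dotpZl, dotpZr).

Lemma dotp0l u : dotp 0 u = 0.
Proof. by rewrite -(scale0r 0) dotpZl mul0r. Qed.

Lemma dotp0r u : dotp u 0 = 0.
Proof. by rewrite dotpC dotp0l. Qed.

Lemma dotp_ge0 u : 0 <= dotp u u.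
Proof. by apply: sumr_ge0 => i _; rewrite -expr2 sqr_ge0. Qed.

Lemma dotp_eq0 u : dotp u u = 0 -> u = 0.
Proof.
move=> /eqP; rewrite psumr_eq0 => [/allP u0|i _]; last by rewrite -expr2 sqr_ge0.
apply/rowP => i; rewrite mxE; apply/eqP.
by have := u0 i (mem_index_enum i); rewrite /= -expr2 sqrf_eq0.
Qed.

Lemma enorm_ge0 u : 0 <= enorm u.
Proof. exact: sqrtr_ge0. Qed.

Lemma sqr_enorm u : enorm u ^+ 2 = dotp u u.
Proof. by rewrite sqr_sqrtr ?dotp_ge0. Qed.

Lemma enorm_eq0 u : enorm u = 0 -> u = 0.
Proof. by move=> u0; apply: dotp_eq0; rewrite -sqr_enorm u0 expr0n. Qed.

Lemma enorm0 : enorm (0 : 'rV[R]_d) = 0.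
Proof. by rewrite /enorm dotp0l sqrtr0. Qed.

Lemma enorm_gt0 u : u != 0 -> 0 < enorm u.
Proof.
move=> u0; rewrite lt_neqAle enorm_ge0 andbT eq_sym.
by apply: contra u0 => /eqP/enorm_eq0/eqP.
Qed.

Lemma enormZ a u : enorm (a *: u) = `|a| * enorm u.
Proof. by rewrite /enorm !dotpE mulrA -expr2 sqrtrM ?sqr_ge0// sqrtr_sqr. Qed.

Lemma enormN u : enorm (- u) = enorm u.
Proof. by rewrite /enorm !dotpE opprK. Qed.

Lemma enormB u v : enorm (u - v) = enorm (v - u).
Proof. by rewrite -enormN opprB. Qed.

Lemma enorm_le u v : (enorm u <= enorm v) = (dotp u u <= dotp v v).
Proof. by rewrite ler_sqrt // dotp_ge0. Qed.

(** Cauchy-Schwarz: the square of the norm of [enorm v *: u - enorm u *: v] equals 2 |u| |v| (|u|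
    |v| - <u, v>). *)
Lemma dotp_le u v : dotp u v <= enorm u * enorm v.
Proof.
have [->|/enorm_gt0 u0] := eqVneq u 0; first by rewrite dotp0l enorm0 mul0r.
have [->|/enorm_gt0 v0] := eqVneq v 0; first by rewrite dotp0r enorm0 mulr0.
have := dotp_ge0 (enorm v *: u - enorm u *: v).
rewrite !dotpE -!sqr_enorm (dotpC v u) => h.
rewrite -subr_ge0 -(pmulr_rge0 _ (mulr_gt0 u0 v0)).
lra.
Qed.

Lemma enormD u v : enorm (u + v) <= enorm u + enorm v.
Proof.
rewrite -(@ler_pXn2r _ 2%N) ?nnegrE ?addr_ge0 ?enorm_ge0//.
rewrite sqr_enorm !dotpE sqrrD !sqr_enorm (dotpC v u).
have := dotp_le u v; lra.
Qed.

Lemma enorm_is_norm : is_norm (@enorm R d).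
Proof. by split; [exact: enormD|exact: enormZ|exact: enorm_eq0]. Qed.

Lemma row_sum_delta u : u = \sum_(i < d) u 0 i *: delta_mx 0 i.
Proof. by rewrite [LHS]matrix_sum_delta big_ord1. Qed.

End Euclidean.

(** * Arbitrary norms: comparison with the sup norm, compact balls *)

Section Norm.
Context {R : realType} {d : nat}.
Variable N : 'rV[R]_d -> R.
Hypothesis N_norm : is_norm N.
Implicit Types (u v w : 'rV[R]_d) (a : R).

Lemma is_normD u v : N (u + v) <= N u + N v. Proof. by case: N_norm. Qed.

Lemma is_normZ a u : N (a *: u) = `|a| * N u. Proof. by case: N_norm. Qed.

Lemma is_norm_eq0 u : N u = 0 -> u = 0. Proof. by case: N_norm => _ _; apply. Qed.

Lemma is_norm0 : N 0 = 0.
Proof. by rewrite -(scale0r 0) is_normZ normr0 mul0r. Qed.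

Lemma is_normN u : N (- u) = N u.
Proof. by rewrite -scaleN1r is_normZ normrN1 mul1r. Qed.

Lemma is_normB u v : N (u - v) = N (v - u).
Proof. by rewrite -is_normN opprB. Qed.

Lemma is_norm_ge0 u : 0 <= N u.
Proof. by have := is_normD u (- u); rewrite subrr is_norm0 is_normN; lra. Qed.

Lemma is_norm_dist u v : `|N u - N v| <= N (u - v).
Proof.
have := is_normD (u - v) v; have := is_normD (v - u) u.
rewrite !subrK (is_normB v u) ler_norml => h1 h2; apply/andP; split; lra.
Qed.

(** Expand [u] in the standard basis and bound each coordinate by the sup norm. The summand 1 keeps
    the constant positive when [d] is 0. *)
Lemma is_norm_upper : exists2 K, 0 < K & forall u, N u <= K * `|u|.
Proof.
exists (1 + \sum_(i < d) N (delta_mx 0 i)) => [|u].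
  by rewrite ltr_pwDl// sumr_ge0// => i _; exact: is_norm_ge0.
rewrite mulrDl mul1r ler_wpDl// mulr_suml [in N u](row_sum_delta u).
elim/big_rec2 : _ => [|i y z _ yz]; first by rewrite is_norm0.
rewrite (le_trans (is_normD _ _))// lerD// is_normZ mulrC ler_wpM2l ?is_norm_ge0//.
rewrite [leRHS]/Num.Def.normr/= mx_normrE.
by apply/bigmax_geP; right; exists (0, i).
Qed.

Lemma is_norm_continuous : continuous N.
Proof.
have [K K0 NK] := is_norm_upper.
move=> u; apply/(@cvgrPdist_le _ _ _ (nbhs u) (nbhs_filter u)) => e e0.
have : \forall v \near u, `|u - v| <= e / K.
  apply/nbhs_normP; exists (e / K); first by rewrite /= divr_gt0.
  by move=> v /= /ltW.
apply: filterS => v uv.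
rewrite (le_trans (is_norm_dist _ _))// (le_trans (NK _))// mulrC.
by rewrite -ler_pdivlMr.
Qed.

(** On the compact unit sphere of the sup norm, [N] attains a minimum, positive by definiteness;
    homogeneity does the rest. If the sphere is empty, every vector is zero. *)
Lemma is_norm_lower : exists2 c, 0 < c & forall u, `|u| <= c * N u.
Proof.
have [[u0 u0n]|S0] := pselect (exists u, `|u| = 1); last first.
  exists 1 => // u; suff -> : `|u| = 0 by rewrite mulr_ge0// is_norm_ge0.
  apply/eqP/negP => /negP u0; apply: S0; exists (`|u|^-1 *: u).
  by rewrite normrZ normfV normr_id mulVf.
pose S := [set u : 'rV[R]_d | `|u| = 1].
have cS : compact S.
  apply: bounded_closed_compact.
    by exists 1; split => // M M1 u /= ->; exact: ltW.
  have -> : S = (fun u : 'rV[R]_d => `|u|) @^-1` [set 1] by [].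
  apply: preimage_closed; last exact: closed_eq.
  by move=> u _; exact: norm_continuous.
have [||c cS' cmin] := @compact_EVT_min _ R N S _ cS.
- by exists u0.
- by apply: continuous_subspaceT => u; exact: is_norm_continuous.
move: cS'; rewrite inE /S /= => c1.
have Nc0 : 0 < N c.
  rewrite lt_neqAle is_norm_ge0 andbT eq_sym; apply/eqP => /is_norm_eq0 c0.
  by move: c1; rewrite c0 normr0 => /eqP; rewrite eq_sym oner_eq0.
exists (N c)^-1; first by rewrite invr_gt0.
move=> u; have [->|u1] := eqVneq u 0.
  by rewrite normr0 mulr_ge0// ?is_norm_ge0// invr_ge0 ltW.
have nu : 0 < `|u| by rewrite normr_gt0.
have /cmin : `|u|^-1 *: u \in S.
  by rewrite inE /S /= normrZ normfV normr_id mulVf// gt_eqF.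
rewrite is_normZ normfV normr_id.
by rewrite !ler_pdivlMl// mulrC.
Qed.

Lemma compact_is_norm_ball w a : compact [set u | N (u - w) <= a].
Proof.
apply: bounded_closed_compact.
  have [c c0 Nc] := is_norm_lower.
  exists (`|w| + c * a); split=> [|M lM u /= ua]; first exact: num_real.
  rewrite -(subrK w u) (le_trans (ler_normD _ _))//.
  rewrite (le_trans _ (ltW lM))// addrC lerD2l (le_trans (Nc _))//.
  by rewrite ler_pM2l.
have cf : continuous (fun u => N (u - w)).
  move=> u; apply: (@continuous_comp _ _ _ (fun v => v - w) N).
    by apply: continuousB => //; exact: cst_continuous.
  exact: is_norm_continuous.
by move/continuous_closedP : cf => /(_ _ (@closed_le R a)).
Qed.

End Norm.

(** * The dual norm *)

Section DualNorm.
Context {R : realType} {d : nat}.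
Variable N : 'rV[R]_d -> R.
Hypothesis N_norm : is_norm N.
Implicit Types (u v w : 'rV[R]_d) (a : R).

(** The real [sup] is meaningful only for nonempty sets bounded above; the bound here comes from
    Cauchy-Schwarz and the equivalence of norms. *)
Lemma has_sup_dual_norm v :
  has_sup [set dotp v u | u in [set u | N u <= 1]].
Proof.
split; first by exists (dotp v 0); exists 0 => //=; rewrite (is_norm0 N_norm).
have [c c0 Nc] := is_norm_lower N_norm.
have [K K0 eK] := is_norm_upper (@enorm_is_norm R d).
exists (enorm v * (K * c)) => _ [u /= u1 <-].
rewrite (le_trans (dotp_le _ _))// ler_wpM2l ?enorm_ge0//.
rewrite (le_trans (eK _))// ler_pM2l// (le_trans (Nc _))//.
by rewrite -[leRHS]mulr1 ler_pM2l.
Qed.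

Lemma dual_norm_ge u v : N u <= 1 -> dotp v u <= dual_norm N v.
Proof.
by move=> u1; apply: ub_le_sup; [case: (has_sup_dual_norm v)|exists u].
Qed.

Lemma dual_norm_le v a :
  (forall u, N u <= 1 -> dotp v u <= a) -> dual_norm N v <= a.
Proof.
move=> h; apply: ge_sup; first by case: (has_sup_dual_norm v).
by move=> _ [u u1 <-]; exact: h.
Qed.

Lemma dual_norm_ge0 v : 0 <= dual_norm N v.
Proof. by rewrite -(dotp0r v) dual_norm_ge// (is_norm0 N_norm). Qed.

Lemma dotp_le_dual u v : dotp v u <= dual_norm N v * N u.
Proof.
have [->|u0] := eqVneq u 0; first by rewrite dotp0r (is_norm0 N_norm) mulr0.
have Nu : 0 < N u.
  rewrite lt_neqAle (is_norm_ge0 N_norm) andbT eq_sym.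
  by apply: contra u0 => /eqP/(is_norm_eq0 N_norm) ->.
rewrite -ler_pdivrMr// mulrC -dotpZr dual_norm_ge//.
by rewrite (is_normZ N_norm) ger0_norm ?invr_ge0 ?(ltW Nu)// mulVf// gt_eqF.
Qed.

Lemma dual_normN v : dual_norm N (- v) = dual_norm N v.
Proof.
wlog suff h : v / dual_norm N (- v) <= dual_norm N v.
  by apply/eqP; rewrite eq_le h -{1}(opprK v) h.
apply: dual_norm_le => u u1; rewrite dotpNl -dotpNr dual_norm_ge//.
by rewrite (is_normN N_norm).
Qed.

Lemma dual_normZ a v : 0 < a -> dual_norm N (a *: v) = a * dual_norm N v.
Proof.
(* One inequality suffices: applied to [a^-1] and [a *: v], it gives the other. *)
wlog suff h : a v / 0 < a -> dual_norm N (a *: v) <= a * dual_norm N v.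
  move=> a0; apply/eqP; rewrite eq_le h//= -ler_pdivlMl//.
  have := h a^-1 (a *: v); rewrite scalerA mulVf ?gt_eqF// scale1r invr_gt0.
  exact.
move=> a0; apply: dual_norm_le => u u1.
by rewrite dotpZl ler_pM2l// dual_norm_ge.
Qed.

Lemma dual_norm_eq0 v : dual_norm N v = 0 -> v = 0.
Proof.
move=> v0; apply: dotp_eq0; apply/eqP; rewrite eq_le dotp_ge0 andbT.
by rewrite (le_trans (dotp_le_dual _ _))// v0 mul0r.
Qed.

End DualNorm.

(** * Nearest points and the distance function *)

Lemma cvg_dotp {R : realType} {d : nat} {T : Type} (F : set_system T)
    {FF : Filter F} (f g : T -> 'rV[R]_d) u v :
  f @ F --> u -> g @ F --> v -> (fun t => dotp (f t) (g t)) @ F --> dotp u v.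
Proof.
move=> fu gv; apply: cvg_big => [|i _]; first exact: add_continuous.
apply: cvgM.
  exact: (cvg_comp _ _ fu (@coord_continuous R 1 d 0 i u)).
exact: (cvg_comp _ _ gv (@coord_continuous R 1 d 0 i v)).
Qed.

Section Projection.
Context {R : realType} {d : nat}.
Variable C : set 'rV[R]_d.
Implicit Types (u v w z : 'rV[R]_d).

Lemma exists_proj z : closed C -> C !=set0 -> exists u, is_proj C z u.
Proof.
move=> Ccl [c Cc].
(* Points of [C] farther from [z] than [c] cannot be nearest, so the search is confined to a compact
   set. *)
pose K := [set u | enorm (u - z) <= enorm (c - z)] `&` C.
have cK : compact K.
  apply: compact_closedI => //.
  exact: (compact_is_norm_ball (@enorm_is_norm R d)).
have [||u uK umin] := @compact_EVT_min _ R (fun u => enorm (u - z)) K _ cK.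
- by exists c; split => /=.
- apply: continuous_subspaceT => u.
  apply: (@continuous_comp _ _ _ (fun v => v - z) enorm).
    by apply: continuousB => //; exact: cst_continuous.
  exact: (is_norm_continuous (@enorm_is_norm R d)).
move: uK; rewrite inE => -[/= uc Cu].
exists u; split=> // y Cy; have [yc|/ltW yc] := leP (enorm (y - z)) (enorm (c - z)).
  by apply: umin; rewrite inE.
exact: le_trans yc.
Qed.

Lemma is_proj_le z u v : is_proj C z u -> C v -> enorm (z - u) <= enorm (z - v).
Proof. by move=> [_ h] /h; rewrite enormB (enormB v). Qed.

Variable p : 'rV[R]_d -> 'rV[R]_d.
Hypothesis proj_p : forall z, is_proj C z (p z).

Lemma dist_lipschitz z w : enorm (z - p z) <= enorm (w - p w) + enorm (z - w).
Proof.
have [Cpw _] := proj_p w.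
rewrite (le_trans (is_proj_le (proj_p z) Cpw))//.
by rewrite -[z - _](subrKA w) addrC enormD.
Qed.

Lemma dist_continuous : continuous (fun z => enorm (z - p z)).
Proof.
move=> z; have [K K0 eK] := is_norm_upper (@enorm_is_norm R d).
apply/(@cvgrPdist_le _ _ _ (nbhs z) (nbhs_filter z)) => e e0.
have : \forall w \near z, `|z - w| <= e / K.
  apply/nbhs_normP; exists (e / K); first by rewrite /= divr_gt0.
  by move=> w /= /ltW.
apply: filterS => w zw.
have zwe : enorm (z - w) <= e.
  by rewrite (le_trans (eK _))// mulrC -ler_pdivlMr.
have := dist_lipschitz z w; have := dist_lipschitz w z.
by rewrite (enormB w z) ler_norml => h1 h2; apply/andP; split; lra.
Qed.

(** The distance grows at almost unit speed away from [p w]. With D = |w - p w| and q = p w', the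
    square |w' - q|^2 is |w - q|^2 + 2 s <w - q, w - p w> + s^2 D^2; here |w - q| >= D, and
    continuity keeps the inner product above (1 - e) D^2 for small s. *)
Lemma dist_increase w e delta : {for w, continuous p} -> w != p w ->
  0 < e -> 0 < delta ->
  exists s, [/\ 0 < s, s < delta &
    let w' := w + s *: (w - p w) in
    enorm (w - p w) + (1 - e) * enorm (w' - w) < enorm (w' - p w')].
Proof.
(* The claim gets stronger as [e] decreases, so [1/2] serves for every [e] at least 1. *)
wlog e1 : e / e < 1 => [hw pw wp e0 d0|pw wp e0 d0].
  have [/hw|e1] := ltP e 1; first exact.
  have [||s [s0 sd h]] := hw (1/2) _ pw wp _ d0; [lra|lra|].
  exists s; split=> //; apply: le_lt_trans h; rewrite lerD2l.
  by apply: ler_wpM2r; [exact: enorm_ge0|lra].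
have d_gt0 : 0 < enorm (w - p w) by rewrite enorm_gt0// subr_eq0.
set D := enorm (w - p w) in d_gt0 *.
have cs : (fun s : R => p (w + s *: (w - p w))) @ 0^'+ --> p w.
  have cs : (fun s : R => w + s *: (w - p w)) @ 0^'+ --> w + 0 *: (w - p w).
    apply: cvgD; first exact: cvg_cst.
    by apply: cvgZ; [exact: cvg_at_right_filter|exact: cvg_cst].
  rewrite scale0r addr0 in cs.
  exact: (cvg_comp _ _ cs pw).
have : \forall s \near 0^'+,
    (1 - e) * D ^+ 2 < dotp (w - p (w + s *: (w - p w))) (w - p w).
  have cd : (fun s : R => dotp (w - p (w + s *: (w - p w))) (w - p w)) @ 0^'+
      --> dotp (w - p w) (w - p w).
    apply: cvg_dotp; last exact: cvg_cst.
    by apply: cvgB => //; exact: cvg_cst.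
  apply: (cvgr_gt _ cd).
  by rewrite -sqr_enorm -/D gtr_pMl ?exprn_gt0//; lra.
move=> near_dot.
have : \forall s \near (0 : R)^'+, 0 < s /\ s < delta.
  by near=> s; split; near: s; [exact: nbhs_right_gt|exact: nbhs_right_lt].
move=> /(filterI near_dot) /filter_ex[s [dots [s0 sd]]].
exists s; split=> //=.
rewrite addrAC subrr add0r enormZ -/D ger0_norm ?(ltW s0)//.
set w' := w + s *: (w - p w) in dots *; set q := p w' in dots *.
rewrite -(@ltr_pXn2r _ 2%N) ?nnegrE ?addr_ge0 ?enorm_ge0 ?mulr_ge0
  ?(ltW d_gt0) ?(ltW s0)//; last first.
  lra.
have : D ^+ 2 <= dotp (w - q) (w - q).
  rewrite -sqr_enorm lerXn2r ?nnegrE ?enorm_ge0//.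
  by apply: is_proj_le => //; case: (proj_p w').
rewrite (sqr_enorm (w' - q)) (_ : w' - q = (w - q) + s *: (w - p w)); last first.
  by rewrite /w' addrAC.
move: dots; have := sqr_enorm (w - p w); rewrite -/D.
move: (w - q) (w - p w) => a b DE.
rewrite !(dotpDl, dotpDr, dotpZl, dotpZr) (dotpC b a) -DE.
set X := dotp a b; set Y := dotp a a => dots YD.
have : 0 < s * (X - (1 - e) * D ^+ 2) by rewrite mulr_gt0// subr_gt0.
have : 0 <= (1 - (1 - e) ^+ 2) * (s * D) ^+ 2.
  by rewrite mulr_ge0 ?sqr_ge0//; nra.
nra.
Unshelve. all: by end_near. Qed.

(* Maximise [dist(w, C) - (1 - e) |w - z|] over the ball of radius [r]: since the
   distance to [C] grows at unit speed, the maximiser lies on the sphere. As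
   [e -> 0] some [w] on the sphere has distance at least [r + dist(z, C)], and
   equality in the triangle inequality puts it on the ray from [p z] through [z]. *)
Lemma proj_extend z r : 0 < r -> z != p z ->
  (forall w, enorm (w - z) < r -> {for w, continuous p}) ->
  is_proj C (z + (r / enorm (z - p z)) *: (z - p z)) (p z).
Proof.
move=> r0 zp cp.
set D := enorm (z - p z).
have D0 : 0 < D by rewrite enorm_gt0// subr_eq0.
pose B := [set w | enorm (w - z) <= r].
have cB : compact B by exact: (compact_is_norm_ball (@enorm_is_norm R d)).
have Bz : B z by rewrite /B /= subrr enorm0 ltW.
(* A single maximiser of the distance inherits the bounds obtained for all [e], so no limit of the
   [e]-dependent maximisers has to be taken. *)
have [||wm wmB wmax] := @compact_EVT_max _ R (fun w => enorm (w - p w)) B _ cB.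
- by exists z.
- by apply: continuous_subspaceT => w; exact: dist_continuous.
have {}wmax e : 0 < e -> D + (1 - e) * r <= enorm (wm - p wm).
  wlog e1 : e / e < 1 => [h e0|e0].
    have [e1|e1] := ltP e 1; first exact: h.
    by apply: le_trans (h (1/2) _ _); [rewrite lerD2l ler_pM2r//; lra|lra|lra].
  have [||w wB wemax] := @compact_EVT_max _ R
    (fun w => enorm (w - p w) - (1 - e) * enorm (w - z)) B _ cB.
  - by exists z.
  - apply: continuous_subspaceT => w.
    have cz : {for w, continuous (fun v => enorm (v - z))}.
      apply: (@continuous_comp _ _ _ (fun v => v - z) enorm).
        by apply: continuousB => //; exact: cst_continuous.
      exact: (is_norm_continuous (@enorm_is_norm R d)).
    apply: (continuousB (@dist_continuous w)).
    by apply: continuousM => //; exact: cst_continuous.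
  have := wemax z; rewrite inE => /(_ Bz).
  rewrite subrr enorm0 mulr0 subr0 -/D => Dw.
  have rw : r <= enorm (w - z).
    rewrite leNgt; apply/negP => wr.
    have w0 : w != p w.
      apply/eqP => wpw; move: Dw; rewrite -wpw subrr enorm0 sub0r.
      have : 0 <= (1 - e) * enorm (w - z) by rewrite mulr_ge0 ?enorm_ge0//; lra.
      lra.
    (* A step shorter than this keeps [w'] in the ball, where it would beat the maximiser [w]. *)
    have delta0 : 0 < (r - enorm (w - z)) / enorm (w - p w).
      by rewrite divr_gt0 ?subr_gt0// enorm_gt0// subr_eq0.
    have [s [s0 sd /=]] := dist_increase (cp w wr) w0 e0 delta0.
    set w' := w + s *: (w - p w) => inc.
    have tri : enorm (w' - z) <= enorm (w' - w) + enorm (w - z).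
      by rewrite -[w' - z](subrKA w) enormD.
    have w'w : enorm (w' - w) = s * enorm (w - p w).
      by rewrite /w' addrAC subrr add0r enormZ gtr0_norm.
    move: sd; rewrite ltr_pdivlMr ?enorm_gt0 ?subr_eq0// => sd.
    have /wemax : w' \in B by rewrite inE /B /=; lra.
    have : (1 - e) * enorm (w' - z) <= (1 - e) * (enorm (w' - w) + enorm (w - z)).
      by rewrite ler_pM2l// subr_gt0.
    lra.
  have := wmax w wB.
  move: wB; rewrite inE /B /= => wr.
  have -> : r = enorm (w - z) by apply/le_anti; rewrite wr rw.
  lra.
have Dr : D + r <= enorm (wm - p wm).
  apply/ler_addgt0Pr => e e0; have := wmax (e / r) (divr_gt0 e0 r0).
  by rewrite mulrBl mul1r divfK ?gt_eqF// addrA lerBlDr.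
have [Cpz _] := proj_p z.
move: wmB; rewrite inE /B /= => wmr.
(* In D + r <= |wm - p wm| <= |wm - p z| <= |wm - z| + D <= r + D all terms must agree. *)
have hw := is_proj_le (proj_p wm) Cpz.
have tri := enormD (wm - z) (z - p z).
rewrite subrKA -/D in tri.
have wmz : enorm (wm - z) = r by apply/le_anti; lra.
have wmp : enorm (wm - p z) = r + D by apply/le_anti; lra.
have -> : z + (r / D) *: (z - p z) = wm.
  apply/eqP; rewrite -subr_eq0; apply/eqP/dotp_eq0.
  have h1 : dotp (wm - z) (wm - z) = r ^+ 2 by rewrite -sqr_enorm wmz.
  have h2 : dotp (z - p z) (z - p z) = D ^+ 2 by rewrite -sqr_enorm.
  have h3 : dotp (wm - p z) (wm - p z) = (r + D) ^+ 2 by rewrite -sqr_enorm wmp.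
  have h4 : dotp (wm - z) (z - p z) = r * D.
    move: h3; rewrite -(subrKA z wm (- p z)).
    move: (wm - z) (z - p z) h1 h2 => a b h1 h2.
    rewrite dotpDl !dotpDr (dotpC b a) h1 h2; lra.
  have -> : z + (r / D) *: (z - p z) - wm = (r / D) *: (z - p z) - (wm - z).
    by rewrite opprB addrCA addrA addrC.
  move: (wm - z) (z - p z) h1 h2 h4 => a b h1 h2 h4.
  rewrite !(dotpDl, dotpDr, dotpNl, dotpNr, dotpZl, dotpZr).
  rewrite (dotpC b a) h1 h2 h4; field.
  by rewrite gt_eqF.
split=> // y Cy; rewrite enormB wmp (enormB y).
rewrite (le_trans _ (is_proj_le (proj_p wm) Cy))//; lra.
Qed.

End Projection.

(** * Uniform proximal normals near a nondegenerate point *)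

Section Nondegenerate.
Context {R : realType} {d : nat}.
Variables (C : set 'rV[R]_d) (p : 'rV[R]_d -> 'rV[R]_d).
Hypothesis proj_p : forall z, is_proj C z (p z).
Implicit Types (u v w x z : 'rV[R]_d).

Lemma nondegenerate_continuous x : C x -> ~ degenerate C x ->
  exists2 rho : R, 0 < rho &
    forall w, enorm (w - x) < rho -> {for w, continuous p}.
Proof.
move=> Cx ndx.
have [U [xU pU]] : exists U, nbhs x U /\ proj_continuous_over C U.
  apply: contrapT => h; apply: ndx; split=> // U xU pU; apply: h.
  by exists U.
have /nbhs_ballP[e /= e0 eU] := xU.
have [c c0 cN] := is_norm_lower (@enorm_is_norm R d).
(* The Euclidean ball of this radius lies in the sup-norm ball of radius [e]. As that ball is open,
   continuity within it is continuity at each of its points. *)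
exists (e / c); first by rewrite divr_gt0.
move=> w wx.
have := continuous_subspaceW eU (pU p proj_p).
rewrite continuous_open_subspace; last first.
  exact: ball_open.
apply; rewrite inE -ball_normE /= (le_lt_trans (cN _))// mulrC -ltr_pdivlMr//.
by rewrite enormB.
Qed.

Variables (x : 'rV[R]_d) (rho : R).
Hypotheses (Cx : C x) (rho_gt0 : 0 < rho).
Hypothesis cont_p : forall w, enorm (w - x) < rho -> {for w, continuous p}.

(* Extending the segment from [p z] to [z] up to length at least [rho / 2]
   gives a lower bound [rho / 2] on the reach of [C] near [x]. *)
Lemma proj_normal_ineq z u : enorm (z - x) < rho / 4 -> C u ->
  rho * dotp (z - p z) (u - p z) <= enorm (z - p z) * enorm (u - p z) ^+ 2.
Proof.
move=> zx Cu; have [zp|zp] := eqVneq z (p z).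
  by rewrite -{1 3}zp subrr dotp0l enorm0 mulr0 mul0r.
have D0 : 0 < enorm (z - p z) by rewrite enorm_gt0// subr_eq0.
have [] := @proj_extend _ _ _ p proj_p z (rho / 2) _ zp.
- by rewrite divr_gt0.
- move=> w wz; apply: cont_p; rewrite -[w - x](subrKA z).
  by rewrite (le_lt_trans (enormD _ _))//; move: wz zx rho_gt0; lra.
move=> _ /(_ u Cu); set D := enorm (z - p z) in D0 *.
rewrite enorm_le.
set k := rho / 2 / D.
have -> : p z - (z + k *: (z - p z)) = - ((1 + k) *: (z - p z)).
  by apply/rowP => i; rewrite !mxE; ring.
have -> : u - (z + k *: (z - p z)) = (u - p z) - (1 + k) *: (z - p z).
  by apply/rowP => i; rewrite !mxE; ring.
rewrite sqr_enorm.
move: (z - p z) (u - p z) => a b.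
rewrite !(dotpDl, dotpDr, dotpNl, dotpNr, dotpZl, dotpZr) (dotpC b a).
set X := dotp a a; set Y := dotp a b; set Z := dotp b b => h.
have kD : k * D = rho / 2 by rewrite /k divfK// gt_eqF.
(* This says that [p z] is nearest to the extended centre. Multiplying by D and using k D = rho / 2
   gives the bound when Y > 0; otherwise its left side is nonpositive. *)
have : 2 * (1 + k) * Y <= Z by lra.
rewrite -(ler_pM2l D0) => h2.
have [Y0|Y0] := leP Y 0.
  have : 0 <= D * Z by rewrite mulr_ge0 ?dotp_ge0// ltW.
  have : rho * Y <= 0 by rewrite mulr_ge0_le0// ltW.
  lra.
have -> : rho * Y = 2 * (k * D) * Y by rewrite kD; field.
have : 0 <= D * Y by rewrite mulr_ge0// ltW.
lra.
Qed.

(** For s = rho / (2 |v|) the hypothesis reads 2 s <v, u - x> <= |u - x|^2, which is the expanded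
    form of [x] being at least as close to [x + s *: v] as [u] is. *)
Lemma proximal_direction v :
  (forall u, C u -> rho * dotp v (u - x) <= enorm v * enorm (u - x) ^+ 2) ->
  exists2 s : R, 0 < s & is_proj C (x + s *: v) x.
Proof.
move=> hv; have [->|v0] := eqVneq v 0.
  exists 1 => //; split=> // u Cu.
  by rewrite scaler0 addr0 subrr enorm0 enorm_ge0.
have {}v0 := enorm_gt0 v0.
exists (rho / (2 * enorm v)); first by rewrite divr_gt0// mulr_gt0.
split=> // u Cu; rewrite enorm_le.
have := hv u Cu; rewrite sqr_enorm; set k := rho / _.
have -> : x - (x + k *: v) = - (k *: v).
  by apply/rowP => i; rewrite !mxE; ring.
have -> : u - (x + k *: v) = (u - x) - k *: v.
  by apply/rowP => i; rewrite !mxE; ring.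
move: (u - x) => b.
rewrite !(dotpDl, dotpDr, dotpNl, dotpNr, dotpZl, dotpZr) (dotpC b v).
have <- : 2 * k * enorm v = rho by rewrite /k; field; rewrite gt_eqF.
move=> h; have : 2 * k * dotp v b <= dotp b b.
  by rewrite -(ler_pM2l v0); lra.
lra.
Qed.

End Nondegenerate.

(** * Approximating points of a segment by points of [C] *)

Lemma ultra_fmap {S T : Type} (f : S -> T) (G : set_system S) :
  UltraFilter G -> UltraFilter (f @ G).
Proof.
move=> GU; split; first exact: fmap_proper_filter.
(* If the preimage of [A] were not in [G], its complement would be, and [H] would contain both [A]
   and its complement. *)
move=> H HF fGH; apply/seteqP; split=> A HA; last exact: fGH.
have [//|] := in_ultra_setVsetC (f @^-1` A) GU.
move=> nA; have /fGH HnA : (f @ G) (~` A) by [].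
by have [y [/= yA nyA]] := filter_ex (filterI HA HnA).
Qed.

Section Approximation.
Context {R : realType} {d : nat}.
Variables (C : set 'rV[R]_d) (p : 'rV[R]_d -> 'rV[R]_d).
Hypothesis proj_p : forall z, is_proj C z (p z).
Variables (x : 'rV[R]_d) (rho : R).
Hypotheses (Cx : C x) (rho_gt0 : 0 < rho).
Hypothesis cont_p : forall w, enorm (w - x) < rho -> {for w, continuous p}.
Variable N : 'rV[R]_d -> R.
Hypothesis N_norm : is_norm N.
Implicit Types (u v w z b e : 'rV[R]_d).

Let E_norm := @enorm_is_norm R d.

(** First-order optimality over a convex ball. Keeping [p z] as competitor avoids differentiating
    the distance: moving [b] towards [b'] by [l] changes the squared distance to [p z] by 2 t l Q +
    (t l)^2 S, which cannot be negative. *)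
Lemma nearest_in_ball w r t : 0 <= r -> 0 < t ->
  exists2 b, N (b - w) <= r &
    let z := x + t *: b in
    forall b', N (b' - w) <= r -> 0 <= dotp (z - p z) (b' - b).
Proof.
move=> r0 t0.
pose B := [set b | N (b - w) <= r].
have cB : compact B by exact: compact_is_norm_ball.
have [||b bB bmin] := @compact_EVT_min _ R
    (fun b => enorm (x + t *: b - p (x + t *: b))) B _ cB.
- by exists w; rewrite /B /= subrr is_norm0.
- apply: continuous_subspaceT => b.
  apply: (@continuous_comp _ _ _ (fun b => x + t *: b) (fun z => enorm (z - p z))).
    apply: continuousD; first exact: cst_continuous.
    exact: scaler_continuous.
  exact: (dist_continuous proj_p).
move: bB; rewrite inE /B /= => bB; exists b => // b' b'B.
rewrite leNgt; apply/negP; set z := x + t *: b => Q0.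
pose Q := dotp (z - p z) (b' - b); rewrite -/Q in Q0.
pose S := dotp (b' - b) (b' - b).
have key l : 0 <= l -> l <= 1 -> 0 <= 2 * (t * l) * Q + (t * l) ^+ 2 * S.
  move=> l0 l1; have /bmin : b + l *: (b' - b) \in B.
    rewrite inE /B /=.
    have -> : b + l *: (b' - b) - w = (1 - l) *: (b - w) + l *: (b' - w).
      by apply/rowP => i; rewrite !mxE; ring.
    rewrite (le_trans (is_normD N_norm _ _))// !(is_normZ N_norm).
    rewrite !ger0_norm ?subr_ge0//; nra.
  set z' := x + t *: (b + l *: (b' - b)) => zz'.
  have [Cz _] := proj_p z.
  have := le_trans zz' (is_proj_le (proj_p z') Cz).
  rewrite enorm_le.
  have -> : z' - p z = (z - p z) + (t * l) *: (b' - b).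
    by rewrite /z' /z; apply/rowP => i; rewrite !mxE; ring.
  rewrite /Q /S; move: (z - p z) (b' - b) => a c.
  rewrite !(dotpDl, dotpDr, dotpZl, dotpZr) (dotpC c a); lra.
have S0 : 0 <= S by exact: dotp_ge0.
(* For Q < 0 this step is at most 1 and satisfies l t S <= - Q, so 2 Q + l t S <= Q < 0. *)
pose l := (- Q) / (t * S - Q).
have den : 0 < t * S - Q by nra.
have l0 : 0 < l by apply: divr_gt0 => //; rewrite oppr_gt0.
have l1 : l <= 1 by rewrite ler_pdivrMr//; nra.
have := key l (ltW l0) l1.
have -> : 2 * (t * l) * Q + (t * l) ^+ 2 * S = t * l * (2 * Q + l * (t * S)) by ring.
rewrite pmulr_rge0 ?(mulr_gt0 t0 l0)// => h.
have : l * (t * S) <= - Q.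
  rewrite /l mulrAC ler_pdivrMr//; nra.
lra.
Qed.

(* With [b t] the point of the [N]-ball of radius [r] about [w] such that
   [x + t b] is closest to [C], and [v t] the residual divided by [t], every
   cluster point [a] of [v] is a proximal normal at [x] satisfying
   [r N*(a) <= <a, w> - |a|^2]; the hypothesis on [w] then forces [a = 0]. *)
Lemma line_approximation w r :
  0 <= r ->
  (forall z, is_proj C z x -> dotp w (z - x) <= r * dual_norm N (z - x)) ->
  forall eps : R, 0 < eps -> \forall t \near (0 : R)^'+,
    exists2 u, C u & N (u - (x + t *: w)) <= (r + eps) * t.
Proof.
move=> r0 hip eps eps0.
have /choice[b hb] : forall t, exists b, 0 < t -> N (b - w) <= r /\
    let z := x + t *: b in
    forall b', N (b' - w) <= r -> 0 <= dotp (z - p z) (b' - b).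
  move=> t; have [t0|t0] := ltP 0 t; last by exists 0.
  by have [b b1 b2] := nearest_in_ball w r0 t0; exists b.
pose z t := x + t *: b t.
pose v t := t^-1 *: (z t - p (z t)).
have zv t : 0 < t -> z t - p (z t) = t *: v t.
  by move=> t0; rewrite /v scalerA mulfV ?scale1r// gt_eqF.
have [M M0 bM] : exists2 M, 0 < M & forall t, 0 < t -> enorm (b t) <= M.
  have [K K0 eK] := is_norm_upper E_norm.
  have [c c0 Nc] := is_norm_lower N_norm.
  exists (1 + K * (c * (r + N w))).
    by rewrite ltr_wpDr// ?ltr01// !mulr_ge0// ?addr_ge0 ?is_norm_ge0// ltW.
  move=> t /hb [bw _]; rewrite (le_trans (eK _))// ler_wpDl// ler_pM2l//.
  rewrite (le_trans (Nc _))// ler_pM2l//.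
  by rewrite -[b t](subrK w) (le_trans (is_normD N_norm _ _))// lerD2r.
have zx t : 0 < t -> enorm (z t - x) <= t * M.
  move=> t0; rewrite /z addrAC subrr add0r enormZ gtr0_norm// ler_pM2l//.
  exact: bM.
have zp t : 0 < t -> enorm (z t - p (z t)) <= t * M.
  by move=> t0; rewrite (le_trans _ (zx t t0))//; exact: is_proj_le.
have px t : 0 < t -> enorm (p (z t) - x) <= 2 * t * M.
  move=> t0; rewrite -[_ - x](subrKA (z t)) (le_trans (enormD _ _))//.
  by rewrite enormB; have := zx t t0; have := zp t t0; lra.
have vM t : 0 < t -> enorm (v t) <= M.
  move=> t0; rewrite -(ler_pM2l t0) -{1}(gtr0_norm t0) -enormZ -zv//; exact: zp.
(* For t < t0, |z t - x| <= t M < rho / 4, the range of [proj_normal_ineq]. *)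
pose t0 := rho / 4 / M.
have t0_gt0 : 0 < t0 by rewrite !divr_gt0.
have normal t u : 0 < t -> t < t0 -> C u ->
    rho * dotp (v t) (u - p (z t)) <= enorm (v t) * enorm (u - p (z t)) ^+ 2.
  move=> tt0 tt Cu; rewrite -(ler_pM2l tt0).
  have := proj_normal_ineq proj_p rho_gt0 cont_p (z := z t) _ Cu.
  rewrite zv// dotpZl enormZ gtr0_norm// => H; rewrite mulrCA [leRHS]mulrA; apply: H.
  by rewrite (le_lt_trans (zx _ tt0))// -ltr_pdivlMr.
pose K := 4 * M ^+ 3 / rho.
(* Optimality against [w - r *: e] gives <v, b> <= <v, w> - r <v, e>. The normal inequality at u =
   x, where x - p z = t (v - b) has norm at most 2 t M, gives |v|^2 - <v, b> <= K t. *)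
have opt t e : 0 < t -> t < t0 -> N e <= 1 ->
    dotp (v t) (v t) - K * t <= dotp (v t) w - r * dotp (v t) e.
  move=> tt0 tt e1.
  have [_ /(_ (w - r *: e)) h1] := hb t tt0.
  have {}h1 : 0 <= dotp (v t) (w - r *: e - b t).
    rewrite -(pmulr_rge0 _ tt0) -dotpZl -zv//; apply: h1.
    rewrite addrAC subrr add0r (is_normN N_norm) (is_normZ N_norm) ger0_norm//.
    by rewrite -[leRHS]mulr1 ler_wpM2l.
  rewrite !(dotpDr, dotpNr, dotpZr) in h1.
  have := normal t x tt0 tt Cx.
  have -> : x - p (z t) = t *: v t - t *: b t.
    by rewrite -zv// /z; apply/rowP => i; rewrite !mxE; ring.
  rewrite -scalerBr dotpZr (dotpDr (v t) (- b t)) (dotpNr (b t)) => h2.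
  have h3 : enorm (v t) * enorm (t *: (v t - b t)) ^+ 2 <= M * (2 * t * M) ^+ 2.
    have -> : t *: (v t - b t) = x - p (z t).
      by rewrite scalerBr -zv// /z; apply/rowP => i; rewrite !mxE; ring.
    rewrite ler_pM ?sqr_ge0 ?enorm_ge0 ?vM// lerXn2r ?nnegrE ?enorm_ge0//.
      by rewrite !mulr_ge0// ltW.
    by rewrite enormB; exact: px.
  have h4 : rho * (dotp (v t) (v t) - dotp (v t) (b t)) <= 4 * M ^+ 3 * t.
    rewrite -(ler_pM2l tt0); lra.
  have : dotp (v t) (v t) - dotp (v t) (b t) <= K * t.
    by rewrite /K mulrAC ler_pdivlMr// mulrC.
  lra.
have v_small eta : 0 < eta -> \forall t \near (0 : R)^'+, enorm (v t) < eta.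
  move=> eta0; apply: contrapT => nsmall.
  (* If [v] does not tend to 0, this filter is proper; along an ultrafilter refining it the bounded
     [v] converges to some [a] with |a| >= eta. *)
  pose F := within [set t | eta <= enorm (v t)] (0 : R)^'+.
  have FF : ProperFilter F.
    apply: Build_ProperFilter_ex => P FP; apply: contrapT => nP; apply: nsmall.
    have {}FP : \forall t \near (0 : R)^'+, eta <= enorm (v t) -> P t := FP.
    apply: filterS FP => t Pt.
    by rewrite ltNge; apply/negP => /Pt h; apply: nP; exists t.
  have [G [GU FG]] := ultraFilterLemma FF.
  have G_right P : (\forall t \near (0 : R)^'+, P t) -> G P.
    by move=> h; apply: FG; apply: filterS h.
  have Gpos : \forall t \near G, 0 < t.
    by apply: G_right; exact: nbhs_right_gt.
  have Glt : \forall t \near G, t < t0.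
    by apply: G_right; exact: nbhs_right_lt.
  have Geta : \forall t \near G, eta <= enorm (v t).
    by apply: FG; rewrite /F /within /=; apply: filterE.
  have cM : compact [set u : 'rV[R]_d | enorm (u - 0) <= M].
    exact: (compact_is_norm_ball E_norm).
  rewrite compact_ultra in cM.
  have [|a [_ va]] := cM (v @ G) (ultra_fmap v GU).
    rewrite /fmap /=; apply: filterS Gpos => t tt0 /=; rewrite subr0; exact: vM.
  have {}va : v @ G --> a := va.
  have tG : (fun t : R => t) @ G --> (0 : R).
    have t_right : (fun t : R => t) @ 0^'+ --> (0 : R).
      by apply: cvg_at_right_filter; exact: cvg_id.
    by move=> P /t_right; exact: G_right.
  have pG : (fun t => p (z t)) @ G --> x.
    have [c c0 Nc] := is_norm_lower E_norm.
    apply/cvgrPdist_le => del del0.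
    have small : \forall t \near G, t < del / (c * (2 * M)).
      by apply: G_right; apply: nbhs_right_lt; rewrite divr_gt0// !mulr_gt0.
    apply: filterS2 Gpos small => t tt0; rewrite ltr_pdivlMr ?mulr_gt0// => tt.
    rewrite (le_trans (Nc _))// enormB (le_trans _ (ltW tt))// mulrCA ler_pM2l//.
    by rewrite (le_trans (px t tt0))// mulrA (mulrC t).
  have vna := cvg_comp _ _ va (@is_norm_continuous _ _ _ E_norm a).
  have ae : eta <= enorm a.
    exact: (ler_cvg_to (cvg_cst eta) vna).
  have [|s s0 sx] := proximal_direction Cx rho_gt0 (v := a).
    move=> u Cu.
    have puG : (fun t => u - p (z t)) @ G --> u - x.
      by apply: cvgB => //; exact: cvg_cst.
    have nuG := cvg_comp _ _ puG (@is_norm_continuous _ _ _ E_norm (u - x)).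
    rewrite expr2.
    have lhs : (fun t => rho * dotp (v t) (u - p (z t))) @ G -->
        rho * dotp a (u - x).
      by apply: cvgM; [exact: cvg_cst|exact: cvg_dotp].
    have rhs : (fun t => enorm (v t) *
          (enorm (u - p (z t)) * enorm (u - p (z t)))) @ G -->
        enorm a * (enorm (u - x) * enorm (u - x)).
      by apply: cvgM => //; exact: cvgM.
    apply: (ler_cvg_to lhs rhs).
    by apply: filterS2 Gpos Glt => t tt0 tt; rewrite -expr2; exact: normal.
  have aopt e : N e <= 1 -> r * dotp a e <= dotp a w - dotp a a.
    move=> e1; suff : dotp a a <= dotp a w - r * dotp a e by lra.
    have lhs : (fun t => dotp (v t) (v t) - K * t) @ G --> dotp a a - K * 0.
      apply: cvgB; first exact: cvg_dotp.
      by apply: cvgM => //; exact: cvg_cst.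
    have rhs : (fun t => dotp (v t) w - r * dotp (v t) e) @ G -->
        dotp a w - r * dotp a e.
      apply: cvgB; first by apply: cvg_dotp => //; exact: cvg_cst.
      apply: cvgM; first exact: cvg_cst.
      by apply: cvg_dotp => //; exact: cvg_cst.
    rewrite mulr0 subr0 in lhs.
    apply: (ler_cvg_to lhs rhs).
    by apply: filterS2 Gpos Glt => t tt0 tt; exact: opt.
  have := hip _ sx.
  rewrite addrAC subrr add0r dotpZr dual_normZ// mulrCA ler_pM2l// dotpC => h.
  have h2 : r * dual_norm N a <= dotp a w - dotp a a.
    (* Passing to the supremum over [e] divides by [r]; for r = 0 the choice e = 0 is enough. *)
    move: r0; rewrite le_eqVlt => /predU1P[r_eq0|r_gt0].
      by have := aopt 0; rewrite is_norm0// -r_eq0 !mul0r; apply.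
    rewrite mulrC -ler_pdivlMr//; apply: dual_norm_le => // e e1.
    by rewrite ler_pdivlMr// mulrC; exact: aopt.
  have : 0 < dotp a a by rewrite -sqr_enorm exprn_gt0// (lt_le_trans eta0).
  lra.
have [L L0 NL] : exists2 L, 0 < L & forall u, N u <= L * enorm u.
  have [K1 K10 eK] := is_norm_upper N_norm.
  have [c c0 Nc] := is_norm_lower E_norm.
  exists (K1 * c); first exact: mulr_gt0.
  by move=> u; rewrite (le_trans (eK _))// -mulrA ler_pM2l.
have := v_small (eps / L) (divr_gt0 eps0 L0).
have : \forall t \near (0 : R)^'+, 0 < t by exact: nbhs_right_gt.
apply: filterS2 => t tt0; rewrite ltr_pdivlMr// => vt.
exists (p (z t)); first by case: (proj_p (z t)).
have -> : p (z t) - (x + t *: w) = t *: ((b t - w) - v t).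
  rewrite scalerBr -zv// /z; apply/rowP => i; rewrite !mxE; ring.
rewrite (is_normZ N_norm) gtr0_norm// mulrC ler_pM2r//.
rewrite (le_trans (is_normD N_norm _ _))// (is_normN N_norm).
have [bw _] := hb t tt0.
by have := NL (v t); lra.
Qed.

End Approximation.

(** * Upper limits and first-order expansions *)

Lemma limf_esup_leP {R : realType} {T : choiceType} {X : filteredType T}
    (f : X -> R) (F : set_system X) (FF : Filter F) (a : R) :
  (limf_esup (EFin \o f) F <= a%:E)%E <->
  forall e : R, 0 < e -> \forall t \near F, f t <= a + e.
Proof.
split=> [fa e e0|fa].
  (* The upper limit is an infimum, over sets of the filter, of suprema: some set has supremum below
     a + e. Conversely, the sublevel set at a + e is such a set. *)
  have /ereal_inf_lt[_ [V FV <-] Va] : (limf_esup (EFin \o f) F < (a + e)%:E)%E.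
    by rewrite (le_lt_trans fa)// lte_fin ltrDl.
  apply: filterS FV => t Vt; rewrite -lee_fin (le_trans _ (ltW Va))//.
  by apply: ereal_sup_ubound; exists t.
apply/lee_addgt0Pr => e e0.
apply: (@le_trans _ _ (ereal_sup ((EFin \o f) @` [set t | f t <= a + e]))).
  by apply: ereal_inf_lbound; exists [set t | f t <= a + e] => //; exact: fa.
by apply: ge_ereal_sup => _ [t /= ft <-]; rewrite lee_fin.
Qed.

Section Gradient.
Context {R : realType} {d : nat}.
Implicit Types (f : 'rV[R]_d -> R) (u v w x z h : 'rV[R]_d).

Lemma dotp_grad f x h : differentiable f x -> dotp h (grad f x) = 'd f x h.
Proof.
move=> df; rewrite [in RHS](row_sum_delta h) linear_sum.
by apply: eq_bigr => i _; rewrite mxE deriveE// linearZ.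
Qed.

Lemma differentiable_upper_bound f x (e : R) : differentiable f x -> 0 < e ->
  \forall h \near (0 : 'rV[R]_d), f (x + h) - f x <= dotp h (grad f x) + e * `|h|.
Proof.
move=> df e0.
have /diff_locallyP[_ /eqaddoP/(_ _ e0)] := df.
apply: filterS => h; rewrite /= !fctE /= (addrC h x) => /ler_normlW.
rewrite dotp_grad//; lra.
Qed.

Lemma differentiable_sqdist z u : differentiable (fun v => dotp (v - z) (v - z)) u.
Proof.
have -> : (fun v => dotp (v - z) (v - z)) =
    \sum_(i < d) ((fun v : 'rV[R]_d => v 0 i) - cst (z 0 i)) ^+ 2.
  apply/funext => v; rewrite fct_sumE; apply: eq_bigr => i _.
  by rewrite !mxE expr2.
apply: differentiable_sum => i; apply: differentiableX.
apply: differentiableB; first exact: differentiable_coord.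
exact: differentiable_cst.
Qed.

Lemma grad_sqdist z x : grad (fun v => dotp (v - z) (v - z)) x = 2 *: (x - z).
Proof.
apply/rowP => i; rewrite !mxE.
set e : 'rV[R]_d := delta_mx 0 i.
have dotpe v : dotp v e = v 0 i.
  rewrite /dotp (bigD1 i)//= big1 => [|j ji]; rewrite mxE eqxx/=.
    by rewrite eqxx mulr1 addr0.
  by rewrite (negbTE ji) mulr0.
rewrite /derive; apply: cvg_lim => //.
(* For nonzero [h] this is the difference quotient along the basis vector [e]. *)
have : (fun h : R => 2 * dotp (x - z) e + h * dotp e e) @ 0^' -->
    2 * dotp (x - z) e + 0 * dotp e e.
  apply: cvgD; first exact: cvg_cst.
  apply: cvgM; last exact: cvg_cst.
  by apply: cvg_within_filter; exact: cvg_id.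
rewrite mul0r addr0 dotpe !mxE; apply: cvg_trans; apply: near_eq_cvg.
near=> h; rewrite /=.
have h0 : h != 0 by near: h; exact: nbhs_dnbhs_neq.
have -> : h *: e + x - z = (x - z) + h *: e by rewrite -addrA addrC.
have -> : x 0 i - z 0 i = dotp (x - z) e by rewrite dotpe !mxE.
move: (x - z) => a.
rewrite !(dotpDl, dotpDr, dotpZl, dotpZr) (dotpC e a) /GRing.scale/=.
by field.
Unshelve. all: by end_near. Qed.

End Gradient.

(** * Implications among the four properties *)

Section Properties.
Context {R : realType} {d : nat}.
Variables (C : set 'rV[R]_d) (N : 'rV[R]_d -> R).
Hypotheses (C_closed : closed C) (C_nonempty : C !=set0) (N_norm : is_norm N).
Implicit Types (x y z u v w : 'rV[R]_d) (r : R).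

Lemma has_inf_ndist u : has_inf [set N (z - u) | z in C].
Proof.
split; first by case: C_nonempty => c Cc; exists (N (c - u)); exists c.
by exists 0 => _ [z _ <-]; exact: is_norm_ge0.
Qed.

Lemma ndist_le u z : C z -> ndist N C u <= N (z - u).
Proof.
by move=> Cz; apply: ge_inf; [case: (has_inf_ndist u)|exists z].
Qed.

Lemma ndist_adherent u (e : R) : 0 < e ->
  exists2 z, C z & N (z - u) < ndist N C u + e.
Proof.
by move=> e0; have [_ [z Cz <-] ?] := inf_adherent e0 (has_inf_ndist u); exists z.
Qed.

Lemma inner_productsP r x y :
  inner_products N C r%:E x y <->
  forall z, is_proj C z x ->
    dotp (y - x) (z - x) <= r * dual_norm N (z - x) * enorm (y - x) ^+ 2.
Proof. by split=> h z /h; rewrite -!EFinM lee_fin. Qed.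

Lemma contractionP r x y :
  Defs.contraction N C r%:E x y <->
  forall z, is_proj C z x ->
    (1 - r * dual_norm N (z - x)) * enorm (x - y) <= enorm (z - y).
Proof.
have E z : ((1 - r%:E * (dual_norm N (z - x))%:E) * (enorm (x - y))%:E)%E =
  ((1 - r * dual_norm N (z - x)) * enorm (x - y))%:E by [].
by split=> h z /h; rewrite E lee_fin.
Qed.

Lemma curvatureP r x y :
  curvature N C r%:E x y <->
  forall e : R, 0 < e -> \forall t \near (0 : R)^'+,
    ndist N C (x + t *: (y - x)) / t <= r * enorm (y - x) ^+ 2 + e.
Proof.
have line t : (1 - t) *: x + t *: y = x + t *: (y - x).
  by apply/rowP => i; rewrite !mxE; ring.
rewrite /curvature -EFinM enormB.
under [X in limf_esup X _]eq_fun do rewrite line.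
exact: limf_esup_leP.
Qed.

Lemma first_orderP r x y :
  first_order N C r%:E x y <->
  forall f : 'rV[R]_d -> R, (forall u, differentiable f u) ->
    (\forall u \near x, C u -> f x <= f u) ->
    - (r * dual_norm N (grad f x) * enorm (y - x) ^+ 2) <= dotp (y - x) (grad f x).
Proof. by split=> h f df /(h f df); rewrite -!EFinM -EFinN lee_fin. Qed.

(** Cauchy-Schwarz: |z - y| |x - y| >= <z - y, x - y> = |x - y|^2 - <z - x, y - x>; then divide by
    |x - y|. *)
Lemma inner_products_contraction r x y : 0 <= r ->
  inner_products N C r%:E x y -> Defs.contraction N C r%:E x y.
Proof.
move=> r0 /inner_productsP h; apply/contractionP => z /h {}h.
have [->|xy] := eqVneq x y; first by rewrite subrr enorm0 mulr0 enorm_ge0.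
have xy0 : 0 < enorm (x - y) by rewrite enorm_gt0// subr_eq0.
rewrite -(ler_pM2r xy0); apply: le_trans (dotp_le _ _).
have -> : z - y = (z - x) - (y - x) by apply/rowP => i; rewrite !mxE; ring.
rewrite -mulrA -expr2 (enormB x); move: h; rewrite sqr_enorm -(opprB y x).
move: (dual_norm _ _) => D; move: (z - x) (y - x) => a b.
rewrite !(dotpDl, dotpNl, dotpNr) (dotpC b a); lra.
Qed.

(** Nearness of [x] to [z] means 2 <z - x, u - x> <= |u - x|^2 on [C]; scaling the left side by [t]
    in [0, 1] preserves this. *)
Lemma is_proj_segment z x (t : R) : 0 <= t -> t <= 1 ->
  is_proj C z x -> is_proj C (x + t *: (z - x)) x.
Proof.
move=> t0 t1 zx; have [Cx _] := zx; split=> // u Cu.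
have := is_proj_le zx Cu; rewrite !enorm_le.
have -> : z - u = (z - x) - (u - x) by apply/rowP => i; rewrite !mxE; ring.
have -> : x - (x + t *: (z - x)) = - (t *: (z - x)).
  by apply/rowP => i; rewrite !mxE; ring.
have -> : u - (x + t *: (z - x)) = (u - x) - t *: (z - x).
  by apply/rowP => i; rewrite !mxE; ring.
move: (z - x) (u - x) => a b.
rewrite !(dotpDl, dotpDr, dotpNl, dotpNr, dotpZl, dotpZr) (dotpC b a) => h.
have : 0 <= (1 - t) * dotp b b by rewrite mulr_ge0 ?dotp_ge0// subr_ge0.
have : 0 <= t * (dotp b b - 2 * dotp a b) by rewrite mulr_ge0//; lra.
lra.
Qed.

Lemma contraction_inner_products r x y : 0 <= r ->
  Defs.contraction N C r%:E x y -> inner_products N C r%:E x y.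
Proof.
move=> r0 /contractionP h; apply/inner_productsP => z zx.
set D := dual_norm N (z - x).
have D0 : 0 <= D by exact: dual_norm_ge0.
have S0 := dotp_ge0 (z - x).
(* Square the contraction inequality at x + t (z - x) and divide by 2 t; the last condition makes
   its left side nonnegative before squaring. *)
have key t : 0 < t -> t <= 1 -> t * (r * D) <= 1 ->
    dotp (y - x) (z - x) <= r * D * enorm (y - x) ^+ 2 + t * dotp (z - x) (z - x).
  move=> t0 t1 t2; have := h _ (is_proj_segment (ltW t0) t1 zx).
  rewrite addrAC subrr add0r dual_normZ// -/D => ht.
  have : ((1 - r * (t * D)) * enorm (x - y)) ^+ 2 <= enorm (x + t *: (z - x) - y) ^+ 2.
    rewrite lerXn2r ?nnegrE ?enorm_ge0// mulr_ge0 ?enorm_ge0//; lra.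
  have -> : x + t *: (z - x) - y = t *: (z - x) - (y - x).
    by apply/rowP => i; rewrite !mxE; ring.
  rewrite exprMn (enormB x) !sqr_enorm.
  move: (z - x) (y - x) => a b.
  rewrite !(dotpDl, dotpDr, dotpNl, dotpNr, dotpZl, dotpZr) (dotpC b a) => hs.
  have sq : 0 <= (r * (t * D)) ^+ 2 * dotp b b by rewrite mulr_ge0 ?sqr_ge0 ?dotp_ge0.
  have : 0 <= t * t * dotp a a by rewrite !mulr_ge0 ?dotp_ge0// ltW.
  by move=> A0; rewrite -(ler_pM2l t0); lra.
apply/ler_addgt0Pr => e e0.
set S := dotp (z - x) (z - x) in key S0.
pose t := Num.min (Num.min 1 (1 + r * D)^-1) (e / (1 + S)).
have rD : 0 <= r * D by exact: mulr_ge0.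
have t0 : 0 < t by rewrite !lt_min ltr01 invr_gt0 divr_gt0//; lra.
have t1 : t <= 1 by rewrite !ge_min lexx.
have t2 : t <= (1 + r * D)^-1 by rewrite !ge_min lexx orbT.
have t3 : t <= e / (1 + S) by rewrite !ge_min lexx !orbT.
rewrite (le_trans (key t t0 t1 _))//.
  by move: t2; rewrite -[_^-1]mul1r ler_pdivlMr; lra.
by rewrite lerD2l; move: t3; rewrite ler_pdivlMr; lra.
Qed.

Lemma first_order_inner_products r x y :
  first_order N C r%:E x y -> inner_products N C r%:E x y.
Proof.
move=> /first_orderP h; apply/inner_productsP => z zx.
have := h (fun v => dotp (v - z) (v - z)) (differentiable_sqdist z).
have xmin : \forall u \near x, C u -> dotp (x - z) (x - z) <= dotp (u - z) (u - z).
  by apply: filterE => u Cu; rewrite -enorm_le; case: zx => _; apply.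
move=> /(_ xmin); rewrite grad_sqdist dual_normZ// -(opprB z x) dual_normN//.
by rewrite dotpZr dotpNr; lra.
Qed.

Lemma curvature_first_order r x y : 0 <= r ->
  curvature N C r%:E x y -> first_order N C r%:E x y.
Proof.
move=> r0 /curvatureP h; apply/first_orderP => f df xmin.
set D := dual_norm N _; set Q := r * enorm (y - x) ^+ 2.
have D0 : 0 <= D by exact: dual_norm_ge0.
have Q0 : 0 <= Q by rewrite mulr_ge0// sqr_ge0.
have [c c0 Nc] := is_norm_lower N_norm.
(* [t * L] bounds the sup norm of the displacement from [x] to the test point. *)
pose L := `|y - x| + c * (Q + 2).
have L0 : 0 <= L by rewrite addr_ge0// mulr_ge0 ?(ltW c0)//; lra.
have key (e : R) : 0 < e -> e <= 1 ->
    - (D * Q) - e * (2 * D + L) <= dotp (y - x) (grad f x).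
  move=> e0 e1.
  have [del /= del0 near0] : exists2 del : R, 0 < del & forall h, `|h| < del ->
      C (x + h) -> 0 <= dotp h (grad f x) + e * `|h|.
    have /nbhs_ballP[d1 /= d10 h1] := xmin.
    have /nbhs_ballP[d2 /= d20 h2] := differentiable_upper_bound (df x) e0.
    exists (Num.min d1 d2) => [|k]; first by rewrite lt_min d10.
    rewrite lt_min => /andP[k1 k2] Ck.
    have fk1 : f x <= f (x + k).
      by apply: h1 => //; rewrite -ball_normE /= opprD addNKr normrN.
    have fk2 : f (x + k) - f x <= dotp k (grad f x) + e * `|k|.
      by apply: h2; rewrite -ball_normE /= sub0r normrN.
    lra.
  have : \forall t \near (0 : R)^'+, 0 < t /\ t < del / (L + 1).
    by near=> t; split; near: t; [exact: nbhs_right_gt|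
      apply: nbhs_right_lt; rewrite divr_gt0//; lra].
  move=> /(filterI (h e e0))/filter_ex[t [ht [t0 tdel]]].
  move: ht; rewrite ler_pdivrMr// => ht.
  have [u Cu ux] := ndist_adherent (x + t *: (y - x)) (mulr_gt0 e0 t0).
  set q := u - _ in ux.
  (* One [e] comes from the upper limit, the other from choosing [u] only nearly closest. *)
  have qQ : N q <= t * (Q + 2 * e) by rewrite /Q; lra.
  have uE : u = x + (t *: (y - x) + q) by rewrite /q addrA subrKC.
  have uL : `|t *: (y - x) + q| <= t * L.
    rewrite (le_trans (ler_normD _ _))// normrZ gtr0_norm// /L mulrDr lerD2l.
    rewrite (le_trans (Nc _))// mulrCA ler_pM2l// (le_trans qQ)// ler_pM2l//.
    lra.
  have udel : `|t *: (y - x) + q| < del.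
    rewrite (le_lt_trans uL)//; move: tdel; rewrite ltr_pdivlMr; nra.
  rewrite uE in Cu; have := near0 _ udel Cu.
  rewrite (dotpDl (t *: (y - x)) q) dotpZl => h1.
  have h2 : dotp q (grad f x) <= D * (t * (Q + 2 * e)).
    rewrite dotpC (le_trans (dotp_le_dual N_norm _ _))//.
    by rewrite ler_wpM2l.
  have h3 : e * `|t *: (y - x) + q| <= e * (t * L) by rewrite ler_pM2l.
  rewrite -(ler_pM2l t0); lra.
have -> : r * D * enorm (y - x) ^+ 2 = D * Q by rewrite /Q; ring.
apply/ler_addgt0Pr => e e0.
pose a := Num.min 1 (e / (2 * D + L + 1)).
have den : 0 < 2 * D + L + 1 by lra.
have a0 : 0 < a by rewrite lt_min ltr01 divr_gt0.
have a1 : a <= 1 by rewrite ge_min lexx.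
have a2 : a <= e / (2 * D + L + 1) by rewrite ge_min lexx orbT.
have := key a a0 a1; move: a2; rewrite ler_pdivlMr//; lra.
Unshelve. all: by end_near. Qed.

Lemma inner_products_curvature r x y : C x -> ~ degenerate C x -> 0 <= r ->
  inner_products N C r%:E x y -> curvature N C r%:E x y.
Proof.
move=> Cx ndx r0 /inner_productsP h; apply/curvatureP => e e0.
have /choice[p proj_p] := fun z => exists_proj z C_closed C_nonempty.
have [rho rho0 cont_p] := nondegenerate_continuous proj_p Cx ndx.
have Q0 : 0 <= r * enorm (y - x) ^+ 2 by rewrite mulr_ge0// sqr_ge0.
have hQ z : is_proj C z x ->
    dotp (y - x) (z - x) <= r * enorm (y - x) ^+ 2 * dual_norm N (z - x).
  by rewrite mulrAC; exact: h.
have := line_approximation proj_p Cx rho0 cont_p N_norm Q0 hQ e0.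
have : \forall t \near (0 : R)^'+, 0 < t by exact: nbhs_right_gt.
apply: filterS2 => t t0 [u Cu ut].
by rewrite ler_pdivrMr// (le_trans (ndist_le _ Cu)).
Qed.

Lemma holds_finite (P Q : property) r x y : C x -> ~ degenerate C x -> 0 <= r ->
  holds P N C r%:E x y -> holds Q N C r%:E x y.
Proof.
move=> Cx ndx r0 hP.
have ip : inner_products N C r%:E x y.
  case: P hP => /=.
  - by move=> /(curvature_first_order r0); exact: first_order_inner_products.
  - exact: contraction_inner_products.
  - exact: first_order_inner_products.
  - by [].
have curv := inner_products_curvature Cx ndx r0 ip.
case: Q => //=.
- exact: inner_products_contraction.
- exact: curvature_first_order.
Qed.

(** A product with +oo is 0 or +oo according to whether the other factor vanishes. Vanishing means y
    = x, z = x or a zero gradient, and then the inequality is checked directly. *)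
Lemma holds_pinfty (P : property) x y : C x -> C y -> holds P N C +oo%E x y.
Proof.
move=> Cx Cy.
have inf_mul v : (+oo * (dual_norm N v)%:E)%E = if v == 0 then 0%E else +oo%E.
  have [->|v0] := eqVneq v 0.
    suff -> : dual_norm N 0 = 0 by rewrite mule0.
    apply/le_anti; rewrite dual_norm_ge0// andbT.
    by apply: dual_norm_le => // u _; rewrite dotp0l.
  rewrite mulyr gtr0_sg ?mul1e// lt_neqAle dual_norm_ge0// andbT eq_sym.
  by apply: contra v0 => /eqP/(dual_norm_eq0 N_norm)/eqP.
have inf_sqr v : v != 0 -> (+oo * (enorm v ^+ 2)%:E)%E = +oo%E.
  by move=> v0; rewrite mulyr gtr0_sg ?mul1e// exprn_gt0// enorm_gt0.
have [->|xy] := eqVneq y x.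
  have i0 : (enorm (x - x) ^+ 2)%:E = 0%E :> \bar R.
    by rewrite subrr enorm0 expr0n.
  case: P => /=.
  - rewrite /curvature i0 mule0; apply/limf_esup_leP => e e0.
    have : \forall t \near (0 : R)^'+, 0 < t by exact: nbhs_right_gt.
    apply: filterS => t t0; rewrite add0r ler_pdivrMr//.
    rewrite (le_trans (ndist_le _ Cx))//.
    rewrite -scalerDl subrK scale1r subrr is_norm0//.
    by rewrite mulr_ge0// ltW.
  - by move=> z _; rewrite subrr enorm0 mule0 lee_fin enorm_ge0.
  - by move=> f _ _; rewrite i0 mule0 oppe0 subrr dotp0l.
  - by move=> z _; rewrite i0 mule0 subrr dotp0l.
have yx0 : y - x != 0 by rewrite subr_eq0.
have xy0 : x - y != 0 by rewrite subr_eq0 eq_sym.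
case: P => /=.
- by rewrite /curvature inf_sqr// leey.
- move=> z _; rewrite inf_mul; case: ifP => [|_].
    rewrite subr_eq0 => /eqP ->.
    by rewrite sube0 mul1e.
  have -> : (1 - +oo = -oo :> \bar R)%E by [].
  by rewrite mulNyr gtr0_sg ?enorm_gt0// mul1e leNye.
- move=> f _ _; rewrite inf_mul; case: ifP => [/eqP ->|_].
    by rewrite mul0e oppe0 dotp0r.
  by rewrite inf_sqr// leNye.
- move=> z _; rewrite inf_mul; case: ifP => [/eqP ->|_].
    by rewrite mul0e dotp0r.
  by rewrite inf_sqr// leey.
Qed.

(** * Equality and attainment of the minimal constants *)

Lemma admissible_sub (P Q : property) x : C x -> ~ degenerate C x ->
  admissible P N C x `<=` admissible Q N C x.
Proof.
move=> Cx ndx [r| |] [/= g0 hP]; split=> //= y Cy.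
- exact: holds_finite (hP y Cy).
- exact: holds_pinfty.
Qed.

(** Each pair [y], [z] imposes a condition linear in the constant, with coefficient D E >= 0. If D E
    > 0, dividing gives a lower bound, which the infimum respects; if D E = 0, the condition is the
    same for every constant and is read off at +oo. *)
Lemma inner_products_inf x : C x ->
  admissible InnerProducts N C x (ereal_inf (admissible InnerProducts N C x)).
Proof.
move=> Cx; set A := admissible _ _ _ _; set g := ereal_inf A.
have g0 : (0 <= g)%E by apply: le_ereal_inf_tmp => a [].
split=> //= y Cy z zx.
set D := dual_norm N (z - x); set E := enorm (y - x) ^+ 2.
have DE : 0 <= D * E by rewrite mulr_ge0 ?sqr_ge0// dual_norm_ge0.
have adm a : A a -> ((dotp (y - x) (z - x))%:E <= a * (D * E)%:E)%E.
  by move=> [_ /(_ y Cy z zx)]; rewrite -muleA.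
rewrite -muleA -EFinM.
have [DE0|DE0] := eqVneq (D * E) 0.
  have := adm +oo%E; rewrite DE0 !mule0; apply; split=> // v Cv.
  exact: (@holds_pinfty InnerProducts).
have {DE0}DE : 0 < D * E by rewrite lt_neqAle eq_sym DE0.
rewrite -lee_pdivrMr//.
by apply: le_ereal_inf_tmp => a /adm; rewrite lee_pdivrMr.
Qed.

End Properties.

Theorem theorem2 (R : realType) (d : nat) (C : set 'rV[R]_d)
    (N : 'rV[R]_d -> R) (C_closed : closed C) (C_nonempty : C !=set0)
    (N_norm : is_norm N) (x : 'rV[R]_d) (Cx : C x) :
  (forall P : property, ~ degenerate C x ->
     admissible P N C x (local_concavity P N C x)) /\
  (forall P Q : property,
     local_concavity P N C x = local_concavity Q N C x).
Proof.
(* Equal admissible sets carry attainment over from inner products to all four properties. *)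
have eqA P Q : ~ degenerate C x -> admissible P N C x = admissible Q N C x.
  by move=> ndx; apply/seteqP; split; exact: admissible_sub.
split=> [P ndx|P Q]; rewrite /local_concavity; case: asboolP => // ndx'.
  by rewrite (eqA P InnerProducts)//; exact: inner_products_inf.
by rewrite (eqA P Q).
Qed.
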